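(* Suppose $a,b>0$ and $n\in\mathbb{Z}^+$. Then \begin{align*} \int_0^\infty\frac{\sin(ax)}{(b^2+x^2)^n}\,\mathrm{d}x&=\frac{1}{b^{2n-1}}\sum_{k=1}^n\binom{2n-k-1}{n-1}\frac{2^{k-2n}}{(k-1)!}\bigg\{(ab)^{k-1}\big[\mathrm{e}^{-ab}\mathrm{Ei}(ab)+(-1)^k\mathrm{e}^{ab}\mathrm{Ei}(-ab)\big]\\ &\quad-\sum_{j=1}^{k-1}(j-1)!\big[1+(-1)^{k+j}\big](ab)^{k-j-1}\bigg\}. \end{align*}
   Context: $\mathbb{Z}^+$ is the set of positive integers. $\mathrm{Ei}$ denotes the exponential integral: for $x>0$, $\mathrm{Ei}(x)=\,-\int_{-x}^\infty \mathrm{e}^{-t}/t\,\mathrm{d}t=\int_{-\infty}^x \mathrm{e}^{t}/t\,\mathrm{d}t$ (Cauchy principal value integrals) and $\mathrm{Ei}(-x)=-\int_x^\infty \mathrm{e}^{-t}/t\,\mathrm{d}t$. Empty sums are equal to zero. *)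

(* Defs.v *)
From Stdlib Require Import Reals ZArith.
From Coquelicot Require Import Coquelicot.
Open Scope R_scope.

(* Cauchy principal value of the integral of [f] over (a, +oo), where a < 0 and
   the singularity to be excised symmetrically is at 0.  Following [RInt_gen],
   the value is meaningful only when the limit exists. *)
Definition is_PV_RInt_infty (f : R -> R) (a l : R) : Prop :=
  filterlim
    (fun eps : R =>
       RInt f a (- eps) + RInt_gen f (at_point eps) (Rbar_locally p_infty))
    (at_right 0) (locally l).

Definition PV_RInt_infty (f : R -> R) (a : R) : R :=
  iota (is_PV_RInt_infty f a).

(* For y < 0 the range of integration avoids 0 and no principal value is
   needed.  Ei has no value at 0; [Ei 0] is arbitrary. *)
Definition Ei (y : R) : R :=
  if Rlt_dec 0 y
  then - PV_RInt_infty (fun t => exp (- t) / t) (- y)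
  else - RInt_gen (fun t => exp (- t) / t) (at_point (- y)) (Rbar_locally p_infty).

(* Main.v *)
Require Import Defs.
From Stdlib Require Import Reals ZArith Lra Lia.
From Coquelicot Require Import Coquelicot.
Open Scope R_scope.

(** Substituting x = b y reduces the integral to b = 1, with c = ab in place
    of a.  Put w = 1 + i y, so that 1 + y^2 is the product of w and its
    conjugate.  Three facts then give the formula.

    Partial fractions ([partial_fractions]): 1 / (1 + y^2)^n is the sum over
    k = 1, ..., n of C(2n-k-1, n-1) 2^(k-2n) times 2 Re (w^(-k)).  This accounts
    for the outer sum of the formula.

    Integration by parts ([osc_integrals]): the derivative of w^(-k) is
    - i k w^(-k-1), so the integrals S_k of sin(c y) Re (w^(-k)) and T_k of
    cos(c y) Im (w^(-k)) satisfy S_(k+1) = (c/k) T_k and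
    T_(k+1) = (c S_k - 1) / k.  The boundary terms -1/k, carried along this
    recurrence, produce the inner sum over j.

    The case k = 1 ([base_integrals]), where Ei enters.  Integrating
    exp(-s) sin(x s) over s in [c, +oo[ gives
    exp(-c) (sin(c x) + x cos(c x)) / (1 + x^2), while integrating it over x in
    [0, X] gives exp(-s) (1 - cos(X s)) / s; as X tends to infinity the cosine
    part of the s-integral vanishes, by integration by parts, and the integral
    of exp(-s) / s over [c, +oo[, which is -Ei(-c), remains
    ([E1_integral]).  Since the principal value at 0 pairs s with -s, the same
    computation with the weight exp(s) - exp(-s) on ]0, c] yields Ei(c) - Ei(-c)
    ([sinh_integral], [Ei_pos_eq]).  Both cases rest on [RInt_sin_estimate], an
    O(1/X) bound that is uniform in the other limit, so that the two limits may
    be exchanged ([common_limit]). *)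

(** * Improper integrals and exchange of limits *)

Lemma is_RInt_gen_p_infty (f : R -> R) (a l : R) :
  (forall X, a <= X -> ex_RInt f a X) ->
  filterlim (fun X => RInt f a X) (Rbar_locally p_infty) (locally l) ->
  is_RInt_gen f (at_point a) (Rbar_locally p_infty) l.
Proof.
  intros Hex Hlim P HP.
  apply (Filter_prod _ _ _ (fun x => x = a)
           (fun X => a <= X /\ P (RInt f a X))).
  - reflexivity.
  - apply filter_and.
    + exists a; intros x Hx; now apply Rlt_le.
    + exact (Hlim P HP).
  - intros x X -> [HX HPX]; exists (RInt f a X); split.
    + apply (@RInt_correct R_CompleteNormedModule), Hex, HX.
    + exact HPX.
Qed.

(** If P X is within K / X of Phi for every X >= 1, eventually along F, then
    Phi along F and P at infinity converge to the same limit; the existence of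
    that limit is part of the conclusion. *)
Lemma common_limit {T : Type} (F : (T -> Prop) -> Prop) {FF : ProperFilter F}
    (Phi : T -> R) (P : R -> R) (K : R) :
  (forall X, 1 <= X -> F (fun t => Rabs (P X - Phi t) <= K / X)) ->
  exists l, filterlim Phi F (locally l) /\
            filterlim P (Rbar_locally p_infty) (locally l).
Proof.
  intros H.
  assert (HK : 0 <= K).
  { destruct (filter_ex _ (H 1 (Rle_refl 1))) as [t Ht].
    unfold Rdiv in Ht; rewrite Rinv_1, Rmult_1_r in Ht.
    eapply Rle_trans; [apply Rabs_pos | exact Ht]. }
  (* beyond this X the error K / X is below eps *)
  assert (Hsmall : forall e : posreal, forall X, 1 + K / e <= X ->
            1 <= X /\ K / X < e).
  { intros e X HX; pose proof (cond_pos e) as He.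
    assert (0 <= K / e) by (apply Rdiv_le_0_compat; lra).
    assert (HX1 : 1 <= X) by lra.
    split; [exact HX1|].
    apply Rmult_lt_reg_r with X; [lra|].
    replace (K / X * X) with K by (field; lra).
    replace K with (e * (K / e)) by (field; lra).
    apply Rmult_lt_compat_l; lra. }
  destruct (proj1 (@filterlim_locally_cauchy T R_CompleteSpace F FF Phi))
    as [l Hl].
  { intros e.
    destruct (Hsmall (pos_div_2 e) _ (Rle_refl _)) as [HX1 HX].
    set (X := 1 + K / pos_div_2 e) in *.
    exists (fun t => Rabs (P X - Phi t) <= K / X); split; [now apply H|].
    intros u v Hu Hv.
    change (Rabs (Phi v - Phi u) < e).
    simpl in HX.
    apply Rabs_def1; apply Rabs_le_between in Hu, Hv; lra. }
  exists l; split; [exact Hl|].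
  apply filterlim_locally; intros e.
  exists (1 + K / pos_div_2 e); intros X HX.
  destruct (Hsmall (pos_div_2 e) X (Rlt_le _ _ HX)) as [HX1 HX2].
  destruct (filter_ex _ (filter_and _ _ (H X HX1)
             (proj1 (filterlim_locally Phi l) Hl (pos_div_2 e)))) as [t [H1 H2]].
  change (Rabs (Phi t - l) < e / 2) in H2.
  change (Rabs (P X - l) < e).
  simpl in HX2.
  apply Rabs_def2 in H2; apply Rabs_le_between in H1.
  apply Rabs_def1; lra.
Qed.


(** * Sine transforms on bounded intervals *)

(** Fubini's theorem on [0, X] x [p, q] for phi(s) sin(x s), whose integral over
    x in [0, X] is phi(s) (1 - cos(X s)) / s.  It is proved by differentiating
    the s-integral with respect to X. *)
Lemma RInt_sin_Fubini (phi J : R -> R) (p q X : R) :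
  (forall s, continuous phi s) -> 0 < p <= q ->
  (forall x, is_RInt (fun s => phi s * sin (x * s)) p q (J x)) ->
  (forall x, continuous J x) ->
  is_RInt J 0 X (RInt (fun s => phi s / s * (1 - cos (X * s))) p q).
Proof.
  intros Hphi Hpq HJ HcJ.
  set (G := fun x => RInt (fun s => phi s / s * (1 - cos (x * s))) p q).
  assert (Hder : forall s, Rmin p q <= s <= Rmax p q -> forall x,
    is_derive (fun x => phi s / s * (1 - cos (x * s))) x (phi s * sin (x * s))).
  { intros s Hs x; rewrite Rmin_left, Rmax_right in Hs by lra.
    auto_derive; [easy|]; field; lra. }
  assert (Hcont : forall x, ex_RInt (fun s => phi s / s * (1 - cos (x * s))) p q).
  { intros x; apply (@ex_RInt_continuous R_CompleteNormedModule); intros s Hs.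
    rewrite Rmin_left, Rmax_right in Hs by lra.
    apply (@continuous_mult R_UniformSpace R_AbsRing).
    - apply (@continuous_mult R_UniformSpace R_AbsRing); [apply Hphi|].
      apply continuous_Rinv; lra.
    - apply @ex_derive_continuous; auto_derive; easy. }
  assert (HG : forall x, is_derive G x (J x)).
  { intros x; unfold G.
    (* J x is the s-integral of the x-derivative of the integrand of G *)
    replace (J x) with
      (RInt (fun s => Derive (fun x => phi s / s * (1 - cos (x * s))) x) p q).
    - apply (is_derive_RInt_param
               (fun x s => phi s / s * (1 - cos (x * s))) p q x).
      + apply filter_forall; intros y t Ht; eexists; now apply Hder.
      + intros t Ht.
        apply continuity_2d_pt_ext_loc with (fun x s => phi s * sin (x * s)).
        * assert (Ht0 : 0 < t) by (rewrite Rmin_left in Ht by lra; lra).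
          exists (mkposreal t Ht0); intros u v _ Hv; simpl in Hv.
          symmetry; apply is_derive_unique.
          apply Rabs_def2 in Hv.
          auto_derive; [easy|]; field; lra.
        * apply continuity_2d_pt_mult.
          -- apply (continuity_1d_2d_pt_comp phi (fun _ s => s)).
             ++ apply continuity_pt_filterlim, Hphi.
             ++ apply continuity_2d_pt_id2.
          -- apply (continuity_1d_2d_pt_comp sin (fun x s => x * s)).
             ++ apply continuity_sin.
             ++ apply continuity_2d_pt_mult;
                  [apply continuity_2d_pt_id1 | apply continuity_2d_pt_id2].
      + now apply filter_forall.
    - rewrite <- (is_RInt_unique _ _ _ _ (HJ x)).
      apply RInt_ext; intros s Hs; apply is_derive_unique, Hder; lra. }
  replace (RInt _ p q) with (minus (G X) (G 0)).
  - apply (@is_RInt_derive R_CompleteNormedModule); intros; [apply HG|apply HcJ].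
  - assert (G0 : G 0 = 0).
    { unfold G; rewrite (RInt_ext _ (fun _ => 0)).
      - rewrite RInt_const; apply Rmult_0_r.
      - intros s _; rewrite Rmult_0_l, cos_0.
        change (phi s / s * (1 - 1) = 0); ring. }
    rewrite G0; apply Rminus_0_r.
Qed.

(** A quantitative Riemann-Lebesgue lemma: if omega' dominates |psi'|, one
    integration by parts bounds the integral of psi(s) cos(X s).  For monotone
    psi, the choice omega = psi or omega = -psi makes the constant depend only
    on the end values of psi. *)
Lemma RInt_cos_bound (psi dpsi omega domega : R -> R) (p q X : R) :
  p <= q -> 0 < X ->
  (forall s, p <= s <= q -> is_derive psi s (dpsi s)) ->
  (forall s, p <= s <= q -> continuous dpsi s) ->
  (forall s, p <= s <= q -> is_derive omega s (domega s)) ->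
  (forall s, p <= s <= q -> continuous domega s) ->
  (forall s, p <= s <= q -> Rabs (dpsi s) <= domega s) ->
  Rabs (RInt (fun s => psi s * cos (X * s)) p q) <=
    (Rabs (psi p) + Rabs (psi q) + (omega q - omega p)) / X.
Proof.
  intros Hpq HX Hpsi Hdpsi Hom Hdom Hle.
  (* the integrand is the derivative of psi(s) sin(X s) / X *)
  assert (H1 : is_RInt (fun s => dpsi s * (sin (X * s) / X) + psi s * cos (X * s))
            p q (psi q * (sin (X * q) / X) - psi p * (sin (X * p) / X))).
  { apply (@is_RInt_derive R_CompleteNormedModule
             (fun s => psi s * (sin (X * s) / X)));
      intros s Hs; rewrite Rmin_left, Rmax_right in Hs by lra.
    - evar_last.
      + apply (is_derive_mult psi (fun s => sin (X * s) / X) s (dpsi s) (cos (X * s))).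
        * now apply Hpsi.
        * auto_derive; [easy|]; field; lra.
        * intros; apply Rmult_comm.
      + reflexivity.
    - apply (@continuous_plus R_UniformSpace R_AbsRing R_NormedModule).
      + apply (@continuous_mult R_UniformSpace R_AbsRing); [now apply Hdpsi|].
        apply @ex_derive_continuous; auto_derive; easy.
      + apply (@continuous_mult R_UniformSpace R_AbsRing).
        * apply @ex_derive_continuous; eexists; now apply Hpsi.
        * apply @ex_derive_continuous; auto_derive; easy. }
  assert (H2 : ex_RInt (fun s => dpsi s * (sin (X * s) / X)) p q).
  { apply (@ex_RInt_continuous R_CompleteNormedModule);
      intros s Hs; rewrite Rmin_left, Rmax_right in Hs by lra.
    apply (@continuous_mult R_UniformSpace R_AbsRing); [now apply Hdpsi|].
    apply @ex_derive_continuous; auto_derive; easy. }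
  destruct H2 as [I HI].
  assert (HIb : Rabs I <= (omega q - omega p) / X).
  { apply (norm_RInt_le (V := R_NormedModule)
             (fun s => dpsi s * (sin (X * s) / X)) (fun s => / X * domega s) p q);
      trivial.
    - intros s Hs.
      change (Rabs (dpsi s * (sin (X * s) / X)) <= / X * domega s).
      unfold Rdiv; rewrite !Rabs_mult, (Rabs_pos_eq (/ X))
        by (left; now apply Rinv_0_lt_compat).
      pose proof (Hle s Hs); pose proof (Rabs_pos (dpsi s)).
      assert (Rabs (sin (X * s)) <= 1) by (apply Rabs_le, SIN_bound).
      rewrite <- Rmult_assoc, Rmult_comm.
      apply Rmult_le_compat_l; [left; now apply Rinv_0_lt_compat|].
      pose proof (Rabs_pos (sin (X * s))); nra.
    - replace ((omega q - omega p) / X) with (/ X * (omega q - omega p))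
        by (unfold Rdiv; ring).
      apply (@is_RInt_scal R_NormedModule domega p q (/ X)).
      apply (@is_RInt_derive R_CompleteNormedModule omega);
        intros s Hs; rewrite Rmin_left, Rmax_right in Hs by lra; auto. }
  assert (H3 : is_RInt (fun s => psi s * cos (X * s)) p q
    (psi q * (sin (X * q) / X) - psi p * (sin (X * p) / X) - I)).
  { generalize (is_RInt_minus (V := R_NormedModule) _ _ _ _ _ _ H1 HI).
    apply is_RInt_ext; intros s _; unfold minus, plus, opp; simpl; ring. }
  rewrite (is_RInt_unique _ _ _ _ H3).
  assert (Hb : forall t r, Rabs (t * (sin r / X)) <= Rabs t / X).
  { intros t r; unfold Rdiv; rewrite !Rabs_mult, (Rabs_pos_eq (/ X))
      by (left; now apply Rinv_0_lt_compat).
    rewrite <- Rmult_assoc.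
    apply Rmult_le_compat_r; [left; now apply Rinv_0_lt_compat|].
    assert (Rabs (sin r) <= 1) by (apply Rabs_le, SIN_bound).
    pose proof (Rabs_pos t); nra. }
  pose proof (Hb (psi q) (X * q)) as Hq; pose proof (Hb (psi p) (X * p)) as Hp.
  unfold Rdiv in *; rewrite !Rmult_plus_distr_r.
  apply Rabs_le_between in Hq, Hp, HIb; apply Rabs_le; lra.
Qed.

(** The integral over [0, X] of J(x), the sine transform of phi over [p, q],
    differs from the integral of phi(s) / s over [p, q] by O(1/X). *)
Lemma RInt_sin_estimate (phi J dpsi omega domega : R -> R) (p q X : R) :
  (forall s, continuous phi s) -> 0 < p <= q -> 0 < X ->
  (forall x, is_RInt (fun s => phi s * sin (x * s)) p q (J x)) ->
  (forall x, continuous J x) ->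
  (forall s, p <= s <= q -> is_derive (fun s => phi s / s) s (dpsi s)) ->
  (forall s, p <= s <= q -> continuous dpsi s) ->
  (forall s, p <= s <= q -> is_derive omega s (domega s)) ->
  (forall s, p <= s <= q -> continuous domega s) ->
  (forall s, p <= s <= q -> Rabs (dpsi s) <= domega s) ->
  Rabs (RInt J 0 X - RInt (fun s => phi s / s) p q) <=
    (Rabs (phi p / p) + Rabs (phi q / q) + (omega q - omega p)) / X.
Proof.
  intros Hphi Hpq HX HJ HcJ Hpsi Hdpsi Hom Hdom Hle.
  rewrite (is_RInt_unique _ _ _ _ (RInt_sin_Fubini phi J p q X Hphi Hpq HJ HcJ)).
  assert (Hc1 : forall s, p <= s <= q -> continuous (fun s => phi s / s) s).
  { intros s Hs; apply @ex_derive_continuous; eexists; now apply Hpsi. }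
  assert (E1 : ex_RInt (fun s => phi s / s) p q).
  { apply (@ex_RInt_continuous R_CompleteNormedModule);
      intros s Hs; rewrite Rmin_left, Rmax_right in Hs by lra; auto. }
  assert (E2 : ex_RInt (fun s => phi s / s * cos (X * s)) p q).
  { apply (@ex_RInt_continuous R_CompleteNormedModule);
      intros s Hs; rewrite Rmin_left, Rmax_right in Hs by lra.
    apply (@continuous_mult R_UniformSpace R_AbsRing); [auto|].
    apply @ex_derive_continuous; auto_derive; easy. }
  rewrite (RInt_ext _ (fun s => minus (phi s / s) (phi s / s * cos (X * s))))
    by (intros s _; unfold minus, plus, opp; simpl; ring).
  rewrite (RInt_minus (V := R_CompleteNormedModule)) by assumption.
  unfold minus, plus, opp; simpl.
  match goal with |- Rabs ?e <= _ =>
    replace e with (- RInt (fun s => phi s / s * cos (X * s)) p q) by ring end.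
  rewrite Rabs_Ropp.
  apply RInt_cos_bound with (psi := fun s => phi s / s) (dpsi := dpsi)
    (domega := domega); trivial; lra.
Qed.

(** * The integrals defining Ei *)

Lemma one_plus_sqr_neq_0 x : 1 + x ^ 2 <> 0.
Proof. pose proof (pow2_ge_0 x); lra. Qed.

(** The common value l is E_1(c) = -Ei(-c).  The weight exp(-s) is first taken
    on [c, T]; [common_limit] is applied with T tending to infinity. *)
Lemma E1_integral (c : R) : 0 < c ->
  exists l,
    is_RInt_gen (fun t => exp (- t) / t) (at_point c) (Rbar_locally p_infty) l /\
    is_RInt_gen (fun x => exp (- c) * (sin (c * x) + x * cos (c * x)) / (1 + x ^ 2))
      (at_point 0) (Rbar_locally p_infty) l.
Proof.
  intros Hc.
  set (A := fun s x => exp (- s) * (sin (s * x) + x * cos (s * x)) / (1 + x ^ 2)).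
  set (psi := fun t => exp (- t) / t).
  assert (HcA : forall s x, continuous (A s) x).
  { intros s x; apply @ex_derive_continuous; unfold A; auto_derive.
    apply one_plus_sqr_neq_0. }
  assert (HeA : forall s X, ex_RInt (A s) 0 X).
  { intros s X; apply (@ex_RInt_continuous R_CompleteNormedModule); auto. }
  assert (Hepsi : forall T, c <= T -> ex_RInt psi c T).
  { intros T HT; apply (@ex_RInt_continuous R_CompleteNormedModule).
    intros s Hs; rewrite Rmin_left, Rmax_right in Hs by lra.
    apply @ex_derive_continuous; unfold psi; auto_derive; lra. }
  assert (HAb : forall T x, Rabs (A T x) <= 2 * exp (- T)).
  { intros T x; unfold A.
    pose proof (exp_pos (- T)) as He.
    pose proof (COS_bound (T * x)); pose proof (SIN_bound (T * x)).
    pose proof (pow2_ge_0 x); pose proof (pow2_ge_0 (x - 1)).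
    pose proof (pow2_ge_0 (x + 1)).
    assert (Hs : Rabs (sin (T * x) + x * cos (T * x)) <= 2 * (1 + x ^ 2)).
    { apply Rabs_le; split; destruct (Rle_dec 0 x); nra. }
    unfold Rdiv; rewrite !Rabs_mult, (Rabs_pos_eq (exp _)) by lra.
    rewrite (Rabs_pos_eq (/ _)) by (left; apply Rinv_0_lt_compat; lra).
    apply Rmult_le_reg_r with (1 + x ^ 2); [lra|].
    rewrite Rmult_assoc, Rinv_l by lra; nra. }
  destruct (common_limit (Rbar_locally p_infty) (fun T => RInt psi c T)
    (fun X => RInt (A c) 0 X) (2 * psi c + 1)) as [l [H1 H2]].
  (* for T >= 2 X^2 the contribution of s > T, at most 2 X exp(-T), is below 1/X *)
  - intros X HX; exists (Rmax c (2 * X * X)); intros T HT.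
    assert (HT1 : c < T) by (eapply Rle_lt_trans; [apply Rmax_l|exact HT]).
    assert (HT2 : 2 * X * X < T) by (eapply Rle_lt_trans; [apply Rmax_r|exact HT]).
    assert (Hpos : forall s, 0 < s -> 0 < psi s).
    { intros s Hs; apply Rdiv_lt_0_compat; [apply exp_pos|exact Hs]. }
    assert (Hest : Rabs (RInt (fun x => A c x - A T x) 0 X - RInt psi c T)
      <= (Rabs (psi c) + Rabs (psi T) + (- psi T - - psi c)) / X).
    { apply RInt_sin_estimate with (phi := fun s => exp (- s))
       (omega := fun s => - psi s)
       (dpsi := fun s => - (exp (- s) / s + exp (- s) / s ^ 2))
       (domega := fun s => exp (- s) / s + exp (- s) / s ^ 2); try lra.
      - intros s; apply @ex_derive_continuous; auto_derive; easy.
      - intros x.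
        replace (A c x - A T x) with (minus (- A T x) (- A c x))
          by (unfold minus, plus, opp; simpl; ring).
        apply (@is_RInt_derive R_CompleteNormedModule (fun s => - A s x)).
        + intros s _; unfold A; auto_derive; [easy|].
          rewrite (Rmult_comm x s); field; intros H0; nra.
        + intros s _; apply @ex_derive_continuous; auto_derive; easy.
      - intros x; apply (@continuous_minus R_UniformSpace R_AbsRing R_NormedModule);
          apply HcA.
      - intros s Hs; auto_derive; [lra|]; field; lra.
      - intros s Hs; apply @ex_derive_continuous; auto_derive; repeat split;
          try lra; nra.
      - intros s Hs; unfold psi; auto_derive; [lra|]; field; lra.
      - intros s Hs; apply @ex_derive_continuous; auto_derive; repeat split;
          try lra; nra.
      - intros s Hs; rewrite Rabs_Ropp, Rabs_pos_eq; [lra|].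
        pose proof (exp_pos (- s)).
        apply Rplus_le_le_0_compat; apply Rdiv_le_0_compat; try lra; nra. }
    rewrite (Rabs_pos_eq (psi c)), (Rabs_pos_eq (psi T)) in Hest
      by (left; apply Hpos; lra).
    assert (Herr : Rabs (RInt (A T) 0 X) <= 1 / X).
    { eapply Rle_trans.
      - apply abs_RInt_le_const with (M := 2 * exp (- T)); auto; lra.
      - rewrite Rminus_0_r.
        assert (HeT : exp (- T) <= / T).
        { rewrite exp_Ropp; apply Rinv_le_contravar; [nra|].
          pose proof (exp_ineq1_le T); lra. }
        apply Rmult_le_reg_r with X; [lra|].
        replace (1 / X * X) with 1 by (field; lra).
        assert (/ T * (2 * X * X) <= 1).
        { apply Rmult_le_reg_l with T; [nra|].
          rewrite <- Rmult_assoc, Rinv_r by nra; lra. }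
        nra. }
    rewrite (RInt_minus (V := R_CompleteNormedModule) (A c) (A T)) in Hest by auto.
    unfold minus, plus, opp in Hest; simpl in Hest.
    replace ((2 * psi c + 1) / X) with ((psi c + psi T + (- psi T - - psi c)) / X + 1 / X)
      by (field; lra).
    apply Rabs_le_between in Herr, Hest; apply Rabs_le; lra.
  - exists l; split.
    + now apply is_RInt_gen_p_infty.
    + apply (is_RInt_gen_p_infty (A c)); auto.
Qed.

(** In terms of hyperbolic functions, sinh s <= s cosh s; it amounts to saying that
    sinh(s) / s is nondecreasing on ]0, +oo[. *)
Lemma exp_minus_le (s : R) : 0 <= s -> exp s - exp (- s) <= s * (exp s + exp (- s)).
Proof.
  intros Hs.
  set (f := fun s => s * (exp s + exp (- s)) - (exp s - exp (- s))).
  destruct (MVT_gen f 0 s (fun s => s * (exp s - exp (- s)))) as [r [Hr Hf]].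
  - intros x _; unfold f; auto_derive; [easy|]; ring.
  - intros x _; apply continuity_pt_filterlim, @ex_derive_continuous.
    unfold f; auto_derive; easy.
  - rewrite Rmin_left, Rmax_right in Hr by lra.
    assert (Hexp : exp (- r) <= exp r).
    { destruct (Req_dec r 0) as [->|Hr0]; [rewrite Ropp_0; lra|].
      left; apply exp_increasing; lra. }
    assert (f 0 = 0) by (unfold f; rewrite Ropp_0; ring).
    assert (0 <= r * (exp r - exp (- r)) * (s - 0)).
    { apply Rmult_le_pos; [apply Rmult_le_pos|]; lra. }
    unfold f in *; lra.
Qed.

(** The analogue of [E1_integral] for the weight exp(s) - exp(-s) on [d, c],
    with d tending to 0; the antiderivative B(s, x) of the weight times
    sin(x s) vanishes at s = 0. *)
Lemma sinh_integral (c : R) : 0 < c ->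
  exists l,
    filterlim (fun d => RInt (fun s => (exp s - exp (- s)) / s) d c)
      (at_right 0) (locally l) /\
    is_RInt_gen
      (fun x => ((exp c + exp (- c)) * sin (c * x)
                 - x * (exp c - exp (- c)) * cos (c * x)) / (1 + x ^ 2))
      (at_point 0) (Rbar_locally p_infty) l.
Proof.
  intros Hc.
  set (B := fun s x => ((exp s + exp (- s)) * sin (s * x)
                        - x * (exp s - exp (- s)) * cos (s * x)) / (1 + x ^ 2)).
  set (psi := fun s => (exp s - exp (- s)) / s).
  assert (HcB : forall s x, continuous (B s) x).
  { intros s x; apply @ex_derive_continuous; unfold B; auto_derive.
    apply one_plus_sqr_neq_0. }
  assert (HeB : forall s X, ex_RInt (B s) 0 X).
  { intros s X; apply (@ex_RInt_continuous R_CompleteNormedModule); auto. }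
  assert (Hpsipos : forall s, 0 < s -> 0 < psi s).
  { intros s Hs; apply Rdiv_lt_0_compat; [|exact Hs].
    assert (exp (- s) < exp s) by (apply exp_increasing; lra); lra. }
  assert (HBb : forall d X x, 0 < d <= / 2 -> 0 <= x <= X ->
            Rabs (B d x) <= 7 * X * d).
  { intros d X x Hd Hx.
    assert (Hn : Rabs ((exp d + exp (- d)) * sin (d * x)
                        - x * (exp d - exp (- d)) * cos (d * x)) <= 7 * X * d).
    { pose proof (exp_pos d); pose proof (exp_pos (- d)).
      pose proof (exp_ineq1_le (- d)).
      assert (exp d * exp (- d) = 1) by (rewrite <- exp_plus, Rplus_opp_r; apply exp_0).
      assert (exp d <= 2) by nra.
      assert (exp d <= 1 + 2 * d) by nra.
      assert (exp (- d) <= 1).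
      { rewrite <- exp_0; left; apply exp_increasing; lra. }
      assert (0 <= exp d - exp (- d)).
      { assert (exp (- d) < exp d) by (apply exp_increasing; lra); lra. }
      assert (Hsin : Rabs (sin (d * x)) <= d * x).
      { assert (0 <= d * x) by nra.
        pose proof (SIN_bound (d * x)).
        destruct (Rle_dec (d * x) 1) as [Hle|Hle]; [|apply Rabs_le; lra].
        destruct (Req_dec (d * x) 0) as [E|E].
        - rewrite E, sin_0, Rabs_R0; lra.
        - pose proof (sin_lt_x (d * x)); pose proof PI2_1; pose proof PI_RGT_0.
          assert (0 <= sin (d * x)) by (apply sin_ge_0; lra).
          rewrite Rabs_pos_eq; lra. }
      pose proof (COS_bound (d * x)).
      assert (HA1 : Rabs ((exp d + exp (- d)) * sin (d * x)) <= 3 * (d * X)).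
      { rewrite Rabs_mult, (Rabs_pos_eq (_ + _)) by lra.
        apply Rmult_le_compat; try lra; [apply Rabs_pos|].
        apply Rle_trans with (d * x); [exact Hsin|nra]. }
      assert (HA2 : Rabs (x * (exp d - exp (- d)) * cos (d * x)) <= X * (3 * d)).
      { rewrite !Rabs_mult, (Rabs_pos_eq x), (Rabs_pos_eq (_ - _)) by lra.
        assert (Rabs (cos (d * x)) <= 1) by (apply Rabs_le; lra).
        rewrite <- (Rmult_1_r (X * (3 * d))).
        apply Rmult_le_compat; [nra|apply Rabs_pos| |assumption].
        apply Rmult_le_compat; lra. }
      assert (0 <= X * d) by nra.
      apply Rabs_le_between in HA1, HA2; apply Rabs_le; lra. }
    unfold B, Rdiv; rewrite Rabs_mult.
    pose proof (pow2_ge_0 x).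
    rewrite (Rabs_pos_eq (/ _)) by (left; apply Rinv_0_lt_compat; lra).
    rewrite <- (Rmult_1_r (7 * X * d)).
    apply Rmult_le_compat; [apply Rabs_pos| |exact Hn|].
    - left; apply Rinv_0_lt_compat; lra.
    - rewrite <- Rinv_1; apply Rinv_le_contravar; lra. }
  destruct (common_limit (at_right 0) (fun d => RInt psi d c)
    (fun X => RInt (B c) 0 X) (2 * psi c + 1)) as [l [H1 H2]].
  - intros X HX.
    assert (HX3 : 1 <= X * X * X) by nra.
    (* for d <= 1 / (7 X^3) the contribution of s < d, at most 7 X^2 d, is below 1/X *)
    assert (Hr : 0 < Rmin c (/ (7 * (X * X * X)))).
    { apply Rmin_pos; [lra|]; apply Rinv_0_lt_compat; lra. }
    exists (mkposreal _ Hr); intros d Hd Hd0.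
    change (Rabs (d - 0) < Rmin c (/ (7 * (X * X * X)))) in Hd.
    rewrite Rminus_0_r, Rabs_pos_eq in Hd by lra.
    assert (Hd1 : d < c) by (eapply Rlt_le_trans; [exact Hd|apply Rmin_l]).
    assert (Hd2 : d < / (7 * (X * X * X)))
      by (eapply Rlt_le_trans; [exact Hd|apply Rmin_r]).
    assert (Hd3 : d * (7 * (X * X * X)) <= 1).
    { apply Rmult_le_reg_r with (/ (7 * (X * X * X))).
      - apply Rinv_0_lt_compat; lra.
      - rewrite Rmult_assoc, Rinv_r by lra; lra. }
    assert (Hest : Rabs (RInt (fun x => B c x - B d x) 0 X - RInt psi d c)
      <= (Rabs (psi d) + Rabs (psi c) + (psi c - psi d)) / X).
    { apply RInt_sin_estimate with (phi := fun s => exp s - exp (- s))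
       (omega := psi)
       (dpsi := fun s => (exp s + exp (- s)) / s - (exp s - exp (- s)) / s ^ 2)
       (domega := fun s => (exp s + exp (- s)) / s - (exp s - exp (- s)) / s ^ 2);
        try lra.
      - intros s; apply @ex_derive_continuous; auto_derive; easy.
      - intros x.
        apply (@is_RInt_derive R_CompleteNormedModule (fun s => B s x)).
        + intros s _; unfold B; auto_derive; [easy|].
          rewrite (Rmult_comm x s); field; intros H0; nra.
        + intros s _; apply @ex_derive_continuous; auto_derive; easy.
      - intros x; apply (@continuous_minus R_UniformSpace R_AbsRing R_NormedModule);
          apply HcB.
      - intros s Hs; auto_derive; [lra|]; field; lra.
      - intros s Hs; apply @ex_derive_continuous; auto_derive; repeat split;
          try lra; nra.
      - intros s Hs; unfold psi; auto_derive; [lra|]; field; lra.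
      - intros s Hs; apply @ex_derive_continuous; auto_derive; repeat split;
          try lra; nra.
      - intros s Hs; rewrite Rabs_pos_eq; [lra|].
        replace ((exp s + exp (- s)) / s - (exp s - exp (- s)) / s ^ 2) with
          ((s * (exp s + exp (- s)) - (exp s - exp (- s))) / s ^ 2) by (field; lra).
        pose proof (exp_minus_le s).
        apply Rdiv_le_0_compat; [lra|nra]. }
    rewrite (Rabs_pos_eq (psi c)), (Rabs_pos_eq (psi d)) in Hest
      by (left; apply Hpsipos; lra).
    assert (Herr : Rabs (RInt (B d) 0 X) <= 1 / X).
    { eapply Rle_trans.
      - apply abs_RInt_le_const with (M := 7 * X * d); auto; [lra|].
        intros x Hx; apply HBb; [nra|lra].
      - rewrite Rminus_0_r; apply Rmult_le_reg_r with X; [lra|].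
        replace (1 / X * X) with 1 by (field; lra); nra. }
    rewrite (RInt_minus (V := R_CompleteNormedModule) (B c) (B d)) in Hest by auto.
    unfold minus, plus, opp in Hest; simpl in Hest.
    replace ((2 * psi c + 1) / X) with ((psi d + psi c + (psi c - psi d)) / X + 1 / X)
      by (field; lra).
    apply Rabs_le_between in Herr, Hest; apply Rabs_le; lra.
  - exists l; split; [exact H1|]; apply (is_RInt_gen_p_infty (B c)); auto.
Qed.

Lemma Ei_opp_eq (c l : R) : 0 < c ->
  is_RInt_gen (fun t => exp (- t) / t) (at_point c) (Rbar_locally p_infty) l ->
  Ei (- c) = - l.
Proof.
  intros Hc Hl; unfold Ei.
  destruct (Rlt_dec 0 (- c)) as [H|_]; [lra|].
  rewrite Ropp_involutive; f_equal.
  apply (@is_RInt_gen_unique R_CompleteNormedModule); [typeclasses eauto..|exact Hl].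
Qed.

(** Folding [-c, -d] onto [d, c] turns the principal value from -c into l1
    minus the limit l2 of an ordinary integral. *)
Lemma Ei_pos_eq (c l1 l2 : R) : 0 < c ->
  is_RInt_gen (fun t => exp (- t) / t) (at_point c) (Rbar_locally p_infty) l1 ->
  filterlim (fun d => RInt (fun s => (exp s - exp (- s)) / s) d c)
      (at_right 0) (locally l2) ->
  Ei c = l2 - l1.
Proof.
  intros Hc H1 H2; unfold Ei.
  destruct (Rlt_dec 0 c) as [_|H]; [|lra].
  replace (l2 - l1) with (- (l1 - l2)) by ring; f_equal.
  apply (@iota_filterlim_locally R_AbsRing R_CompleteNormedModule).
  { typeclasses eauto. }
  apply filterlim_ext_loc with
    (fun d => l1 - RInt (fun s => (exp s - exp (- s)) / s) d c).
  - exists (mkposreal c Hc); intros d Hd Hd0.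
    change (Rabs (d - 0) < c) in Hd; rewrite Rminus_0_r, Rabs_pos_eq in Hd by lra.
    assert (Hex : forall f : R -> R, (forall s, 0 < s -> ex_derive f s) ->
              ex_RInt f d c).
    { intros f Hf; apply (@ex_RInt_continuous R_CompleteNormedModule).
      intros s Hs; rewrite Rmin_left, Rmax_right in Hs by lra.
      apply @ex_derive_continuous, Hf; lra. }
    destruct (Hex (fun t => exp (- t) / t)) as [I1 HI1].
    { intros s Hs; auto_derive; lra. }
    destruct (Hex (fun t => exp t / t)) as [I2 HI2].
    { intros s Hs; auto_derive; lra. }
    rewrite (is_RInt_unique _ d c (I2 - I1)).
    2:{ generalize (is_RInt_minus (V := R_NormedModule) _ _ _ _ _ _ HI2 HI1).
        apply is_RInt_ext; intros s _; unfold minus, plus, opp; simpl.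
        unfold Rdiv; ring. }
    (* substitution s -> -s on the negative half *)
    rewrite (is_RInt_unique _ (- c) (- d) (- I2)).
    2:{ apply is_RInt_swap in HI2.
        rewrite <- (Ropp_involutive c), <- (Ropp_involutive d) in HI2.
        apply is_RInt_comp_opp in HI2.
        revert HI2; apply is_RInt_ext.
        intros s Hs; rewrite Rmin_left, Rmax_right in Hs by lra.
        change (- (exp (- s) / - s) = exp (- s) / s); field; lra. }
    rewrite (@is_RInt_gen_unique R_CompleteNormedModule _ _ _ _
               (fun t => exp (- t) / t) (I1 + l1)).
    + ring.
    + refine (is_RInt_gen_Chasles (V := R_NormedModule) _ c _ _ _ H1).
      now apply is_RInt_gen_at_point.
  - apply filterlim_locally; intros e.
    generalize (proj1 (filterlim_locally _ _) H2 e); apply filter_imp.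
    intros d Hd.
    set (I := RInt _ d c) in *.
    change (Rabs (I - l2) < e) in Hd.
    change (Rabs (l1 - I - (l1 - l2)) < e).
    now replace (l1 - I - (l1 - l2)) with (- (I - l2)) by ring; rewrite Rabs_Ropp.
Qed.

(** * Negative powers of 1 + i y *)

(** Restates an equation between elements of a canonical structure on R as an
    equation in R, the form that [ring] and [field] accept. *)
Ltac eq_R := match goal with |- ?u = ?v => change (@eq R u v) end.

(** The real and imaginary parts of (1 + i y)^(-k), computed by the recursion
    w^(-k-1) = w^(-k) conj(w) / (1 + y^2), where w = 1 + i y. *)
Fixpoint inv_pow (k : nat) (y : R) : R * R :=
  match k with
  | O => (1, 0)
  | S k => let z := inv_pow k y in
      ((fst z + y * snd z) / (1 + y ^ 2), (snd z - y * fst z) / (1 + y ^ 2))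
  end.

Definition inv_pow_re (k : nat) (y : R) : R := fst (inv_pow k y).
Definition inv_pow_im (k : nat) (y : R) : R := snd (inv_pow k y).

Lemma inv_pow_re_S k y :
  inv_pow_re (S k) y = (inv_pow_re k y + y * inv_pow_im k y) / (1 + y ^ 2).
Proof. reflexivity. Qed.

Lemma inv_pow_im_S k y :
  inv_pow_im (S k) y = (inv_pow_im k y - y * inv_pow_re k y) / (1 + y ^ 2).
Proof. reflexivity. Qed.

(** The linear recurrence coming from z + conj(z) = 2 z conj(z), where z = 1/w. *)
Lemma inv_pow_re_SS k y :
  2 * / (1 + y ^ 2) * inv_pow_re (S k) y =
  inv_pow_re (S (S k)) y + / (1 + y ^ 2) * inv_pow_re k y.
Proof.
  rewrite (inv_pow_re_S (S k)), inv_pow_im_S, !inv_pow_re_S.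
  field; intros H; nra.
Qed.

(** The two components of the identity (w^(-k))' = - i k w^(-k-1). *)
Lemma is_derive_inv_pow k y :
  is_derive (inv_pow_re k) y (INR k * inv_pow_im (S k) y) /\
  is_derive (inv_pow_im k) y (- INR k * inv_pow_re (S k) y).
Proof.
  induction k as [|k [IHu IHv]].
  - split.
    + replace (INR 0 * _) with 0 by (simpl; ring).
      apply (is_derive_const (V := R_NormedModule) 1).
    + replace (- INR 0 * _) with 0 by (simpl; ring).
      apply (is_derive_const (V := R_NormedModule) 0).
  - assert (Hd : forall f f' : R, forall F : R -> R, is_derive F y f' -> F y = f ->
      is_derive (fun y => F y / (1 + y ^ 2)) y
        ((f' - 2 * y * (f / (1 + y ^ 2))) / (1 + y ^ 2))).
    { intros f f' F HF <-.
      evar_last.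
      - apply is_derive_div; [exact HF| |apply one_plus_sqr_neq_0].
        instantiate (1 := 2 * y); auto_derive; [easy|ring].
      - cbv beta; field; intros H; nra. }
    assert (Hu : is_derive (fun y => inv_pow_re k y + y * inv_pow_im k y) y
              (INR k * inv_pow_im (S k) y
               + (1 * inv_pow_im k y + y * (- INR k * inv_pow_re (S k) y)))).
    { apply (is_derive_plus (V := R_NormedModule)); [exact IHu|].
      apply (is_derive_mult (fun y => y) (inv_pow_im k) y 1);
        [apply (@is_derive_id R_AbsRing)|exact IHv|].
      intros; apply Rmult_comm. }
    assert (Hv : is_derive (fun y => inv_pow_im k y - y * inv_pow_re k y) y
              (- INR k * inv_pow_re (S k) y
               - (1 * inv_pow_re k y + y * (INR k * inv_pow_im (S k) y)))).
    { apply (is_derive_minus (V := R_NormedModule)); [exact IHv|].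
      apply (is_derive_mult (fun y => y) (inv_pow_re k) y 1);
        [apply (@is_derive_id R_AbsRing)|exact IHu|].
      intros; apply Rmult_comm. }
    split.
    + evar_last; [exact (Hd _ _ _ Hu eq_refl)|].
      rewrite !inv_pow_im_S, !inv_pow_re_S, ?inv_pow_im_S, S_INR.
      field; intros H; nra.
    + evar_last; [exact (Hd _ _ _ Hv eq_refl)|].
      rewrite !inv_pow_re_S, !inv_pow_im_S, ?inv_pow_re_S, S_INR.
      field; intros H; nra.
Qed.

Lemma continuous_inv_pow_re k y : continuous (inv_pow_re k) y.
Proof.
  apply @ex_derive_continuous; eexists; exact (proj1 (is_derive_inv_pow k y)).
Qed.

Lemma continuous_inv_pow_im k y : continuous (inv_pow_im k) y.
Proof.
  apply @ex_derive_continuous; eexists; exact (proj2 (is_derive_inv_pow k y)).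
Qed.

Lemma inv_pow_sqr k y :
  inv_pow_re k y ^ 2 + inv_pow_im k y ^ 2 = (/ (1 + y ^ 2)) ^ k.
Proof.
  induction k as [|k IH].
  - unfold inv_pow_re, inv_pow_im; simpl; ring.
  - rewrite <- (tech_pow_Rmult (/ _)), <- IH, inv_pow_re_S, inv_pow_im_S.
    field; intros H; nra.
Qed.

Lemma inv_pow_le k y : 0 < y ->
  Rabs (inv_pow_re (S k) y) <= / y /\ Rabs (inv_pow_im (S k) y) <= / y.
Proof.
  intros Hy.
  assert (H : inv_pow_re (S k) y ^ 2 + inv_pow_im (S k) y ^ 2 <= (/ y) ^ 2).
  { rewrite inv_pow_sqr, <- (tech_pow_Rmult _ k).
    assert (H1 : / (1 + y ^ 2) <= (/ y) ^ 2).
    { rewrite pow_inv; apply Rinv_le_contravar; nra. }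
    assert (H0 : 0 < / (1 + y ^ 2)) by (apply Rinv_0_lt_compat; nra).
    assert (H2 : (/ (1 + y ^ 2)) ^ k <= 1).
    { apply Rle_trans with (1 ^ k); [|rewrite pow1; lra].
      apply pow_incr; split; [lra|].
      rewrite <- Rinv_1; apply Rinv_le_contravar; nra. }
    assert (0 <= (/ (1 + y ^ 2)) ^ k) by (apply pow_le; lra).
    nra. }
  assert (Hy' : 0 < / y) by now apply Rinv_0_lt_compat.
  split; apply Rabs_le; nra.
Qed.

(** * The oscillatory integrals of negative powers *)

Lemma filterlim_p_infty_0 (F : R -> R) :
  (forall y, 0 < y -> Rabs (F y) <= / y) ->
  filterlim F (Rbar_locally p_infty) (locally 0).
Proof.
  intros H; apply filterlim_locally; intros e.
  exists (/ e); intros y Hy.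
  pose proof (cond_pos e) as He.
  assert (0 < / e) by now apply Rinv_0_lt_compat.
  change (Rabs (F y - 0) < e); rewrite Rminus_0_r.
  eapply Rle_lt_trans; [apply H; lra|].
  rewrite <- (Rinv_inv e); apply Rinv_lt_contravar; nra.
Qed.

(** The fundamental theorem of calculus on [a, +oo[ for an antiderivative F that
    vanishes at infinity. *)
Lemma is_RInt_gen_derive_p_infty (F f : R -> R) (a : R) :
  (forall y, is_derive F y (f y)) -> (forall y, continuous f y) ->
  (forall y, 0 < y -> Rabs (F y) <= / y) ->
  is_RInt_gen f (at_point a) (Rbar_locally p_infty) (- F a).
Proof.
  intros HF Hf Hb.
  assert (HI : forall X, is_RInt f a X (F X - F a)).
  { intros X; apply (@is_RInt_derive R_CompleteNormedModule F); auto. }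
  apply is_RInt_gen_p_infty.
  - intros X _; eexists; apply HI.
  - apply filterlim_ext with (fun X => F X - F a).
    { intros X; symmetry; apply is_RInt_unique, HI. }
    apply filterlim_locally; intros e.
    generalize (proj1 (filterlim_locally _ _) (filterlim_p_infty_0 F Hb) e).
    apply filter_imp; intros X HX.
    change (Rabs (F X - 0) < e) in HX.
    change (Rabs (F X - F a - - F a) < e).
    now replace (F X - F a - - F a) with (F X - 0) by ring.
Qed.

(** The closed form of both families of integrals: e = 1 gives S_k, the integral
    of sin(c y) Re ((1 + i y)^(-k)), and e = -1 gives T_k, the integral of
    cos(c y) Im ((1 + i y)^(-k)).  It is meaningful for k >= 1. *)
Definition osc_value (e c : R) (k : nat) : R :=
  / (2 * INR (fact (k - 1))) *
  (c ^ (k - 1) * (exp (- c) * Ei c + e * (-1) ^ k * exp c * Ei (- c))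
   - sum_n_m (fun j => INR (fact (j - 1)) * (1 + e * (-1) ^ (k + j)) * c ^ (k - j - 1))
       1 (k - 1)).

Lemma osc_value_1 e c :
  osc_value e c 1 = (exp (- c) * Ei c - e * (exp c * Ei (- c))) / 2.
Proof.
  unfold osc_value; simpl.
  rewrite sum_n_m_zero by lia; change (@zero _) with 0; field.
Qed.

(** The recurrence satisfied by the integrals; the constant (1 - e) / 2 is the
    term j = k of the sum. *)
Lemma osc_value_S e c m :
  osc_value e c (S (S m)) =
  (c * osc_value (- e) c (S m) - (1 - e) / 2) / INR (S m).
Proof.
  unfold osc_value.
  replace (S (S m) - 1)%nat with (S m) by lia.
  replace (S m - 1)%nat with m by lia.
  rewrite (sum_n_Sm _ 1 m) by lia.
  rewrite (sum_n_m_ext_loc _ (fun j => c *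
    (INR (fact (j - 1)) * (1 + - e * (-1) ^ (S m + j)) * c ^ (S m - j - 1)))).
  2:{ intros j Hj.
      replace (S (S m) - j - 1)%nat with (S (S m - j - 1)) by lia.
      change (S (S m) + j)%nat with (S (S m + j)).
      eq_R; simpl pow; ring. }
  rewrite (sum_n_m_mult_l (K := R_Ring)).
  change (@mult R_Ring) with Rmult; change (@plus (Ring.AbelianMonoid R_Ring)) with Rplus.
  change (@plus R_AbelianMonoid) with Rplus.
  set (s := sum_n_m _ 1 m).
  replace (S (S m) - S m - 1)%nat with 0%nat by lia.
  replace (S m - 1)%nat with m by lia.
  replace ((-1) ^ (S (S m) + S m)) with (-1).
  2:{ replace (S (S m) + S m)%nat with (S (2 * S m)) by lia.
      now rewrite pow_1_odd. }
  rewrite fact_simpl, mult_INR.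
  pose proof (INR_fact_neq_0 m); pose proof (not_0_INR (S m) (Nat.neq_succ_0 m)).
  simpl pow; field; now split.
Qed.

Lemma base_integrals (c : R) : 0 < c ->
  is_RInt_gen (fun y => sin (c * y) * inv_pow_re 1 y)
    (at_point 0) (Rbar_locally p_infty) (osc_value 1 c 1) /\
  is_RInt_gen (fun y => cos (c * y) * inv_pow_im 1 y)
    (at_point 0) (Rbar_locally p_infty) (osc_value (-1) c 1).
Proof.
  intros Hc.
  destruct (E1_integral c Hc) as [l1 [HE HI1]].
  destruct (sinh_integral c Hc) as [l2 [HPV HI2]].
  rewrite !osc_value_1, (Ei_opp_eq c l1 Hc HE), (Ei_pos_eq c l1 l2 Hc HE HPV).
  assert (Hexp : exp c * exp (- c) = 1) by (rewrite <- exp_plus, Rplus_opp_r; apply exp_0).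
  assert (Hlin : forall r1 r2,
    is_RInt_gen (fun y => r1 * (exp (- c) * (sin (c * y) + y * cos (c * y)) / (1 + y ^ 2))
        + r2 * (((exp c + exp (- c)) * sin (c * y)
                 - y * (exp c - exp (- c)) * cos (c * y)) / (1 + y ^ 2)))
      (at_point 0) (Rbar_locally p_infty) (r1 * l1 + r2 * l2)).
  { intros r1 r2.
    apply (is_RInt_gen_plus (V := R_NormedModule));
      now apply (is_RInt_gen_scal (V := R_NormedModule)). }
  pose proof (exp_pos c); pose proof (exp_pos (- c)).
  assert (Hexp' : exp (- c) = / exp c) by apply exp_Ropp.
  (* the two known integrands combined so as to isolate sin, then y cos *)
  split.
  - replace (_ / 2) with ((exp c - exp (- c)) / 2 * l1 + exp (- c) / 2 * l2) by field.
    generalize (Hlin ((exp c - exp (- c)) / 2) (exp (- c) / 2)).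
    apply is_RInt_gen_ext, filter_forall; intros _ y _.
    unfold inv_pow_re; simpl inv_pow; simpl fst; simpl snd.
    rewrite Hexp'; eq_R; field; split; [intros H1; nra|lra].
  - replace (_ / 2) with (- ((exp c + exp (- c)) / 2) * l1 + exp (- c) / 2 * l2) by field.
    generalize (Hlin (- ((exp c + exp (- c)) / 2)) (exp (- c) / 2)).
    apply is_RInt_gen_ext, filter_forall; intros _ y _.
    unfold inv_pow_im; simpl inv_pow; simpl fst; simpl snd.
    rewrite Hexp'; eq_R; field; split; [intros H1; nra|lra].
Qed.

Lemma osc_integrals (c : R) (m : nat) : 0 < c ->
  is_RInt_gen (fun y => sin (c * y) * inv_pow_re (S m) y)
    (at_point 0) (Rbar_locally p_infty) (osc_value 1 c (S m)) /\
  is_RInt_gen (fun y => cos (c * y) * inv_pow_im (S m) y)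
    (at_point 0) (Rbar_locally p_infty) (osc_value (-1) c (S m)).
Proof.
  intros Hc; induction m as [|m [IHs IHt]]; [now apply base_integrals|].
  set (k := S m) in *.
  assert (Hk : INR k <> 0) by (apply not_0_INR; lia).
  assert (Hsin : forall y, is_derive (fun y => sin (c * y)) y (c * cos (c * y)))
    by (intros y; auto_derive; [easy|ring]).
  assert (Hcos : forall y, is_derive (fun y => cos (c * y)) y (- c * sin (c * y)))
    by (intros y; auto_derive; [easy|ring]).
  assert (Hcsin : forall y, continuous (fun y => sin (c * y)) y)
    by (intros y; apply @ex_derive_continuous; eexists; apply Hsin).
  assert (Hccos : forall y, continuous (fun y => cos (c * y)) y)
    by (intros y; apply @ex_derive_continuous; eexists; apply Hcos).
  assert (Hprod : forall f g r s, (forall y : R, continuous (f : R -> R) y) ->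
    (forall y, continuous (g : R -> R) y) ->
    forall y, continuous (fun y => (r * f y) * (s * g y)) y).
  { intros f g r s Hf Hg y.
    apply (@continuous_mult R_UniformSpace R_AbsRing);
      apply (continuous_scal_r (V := R_NormedModule)); auto. }
  assert (Hbd : forall s y r : R, Rabs s <= 1 -> Rabs r <= / y -> Rabs (s * r) <= / y).
  { intros s y r Hs Hr; rewrite Rabs_mult.
    pose proof (Rabs_pos s); pose proof (Rabs_pos r); nra. }
  assert (D1 : is_RInt_gen (fun y => (c * cos (c * y)) * (1 * inv_pow_im k y)
                 + (1 * sin (c * y)) * (- INR k * inv_pow_re (S k) y))
            (at_point 0) (Rbar_locally p_infty) (- (sin (c * 0) * inv_pow_im k 0))).
  { apply (is_RInt_gen_derive_p_infty (fun y => sin (c * y) * inv_pow_im k y)).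
    - intros y; rewrite !Rmult_1_l.
      apply (is_derive_mult (fun y => sin (c * y)) (inv_pow_im k) y (c * cos (c * y)));
        trivial.
      + exact (proj2 (is_derive_inv_pow k y)).
      + intros; apply Rmult_comm.
    - intros y; apply (@continuous_plus R_UniformSpace R_AbsRing R_NormedModule);
        apply Hprod; trivial; intros z;
        [apply continuous_inv_pow_im|apply continuous_inv_pow_re].
    - intros y Hy; apply Hbd; [apply Rabs_le, SIN_bound|].
      now apply inv_pow_le. }
  assert (D2 : is_RInt_gen (fun y => (- c * sin (c * y)) * (1 * inv_pow_re k y)
                 + (1 * cos (c * y)) * (INR k * inv_pow_im (S k) y))
            (at_point 0) (Rbar_locally p_infty) (- (cos (c * 0) * inv_pow_re k 0))).
  { apply (is_RInt_gen_derive_p_infty (fun y => cos (c * y) * inv_pow_re k y)).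
    - intros y; rewrite !Rmult_1_l.
      apply (is_derive_mult (fun y => cos (c * y)) (inv_pow_re k) y (- c * sin (c * y)));
        trivial.
      + exact (proj1 (is_derive_inv_pow k y)).
      + intros; apply Rmult_comm.
    - intros y; apply (@continuous_plus R_UniformSpace R_AbsRing R_NormedModule);
        apply Hprod; trivial; intros z;
        [apply continuous_inv_pow_re|apply continuous_inv_pow_im].
    - intros y Hy; apply Hbd; [apply Rabs_le, COS_bound|].
      now apply inv_pow_le. }
  assert (H0 : inv_pow_re k 0 = 1).
  { clear; induction k as [|k IH]; [reflexivity|].
    rewrite inv_pow_re_S, IH; field. }
  rewrite Rmult_0_r, sin_0, Rmult_0_l, Ropp_0 in D1.
  rewrite Rmult_0_r, cos_0, Rmult_1_l, H0 in D2.
  rewrite !(osc_value_S _ c m); fold k.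
  split.
  - change (- (1)) with (-1).
    replace ((_ - _) / INR k) with (c / INR k * osc_value (-1) c k + - / INR k * 0)
      by (field; exact Hk).
    generalize (is_RInt_gen_plus (V := R_NormedModule) _ _ _ _
      (is_RInt_gen_scal (V := R_NormedModule) _ (c / INR k) _ IHt)
      (is_RInt_gen_scal (V := R_NormedModule) _ (- / INR k) _ D1)).
    apply is_RInt_gen_ext, filter_forall; intros _ y _.
    unfold plus, scal; simpl; unfold mult; simpl.
    eq_R; field; exact Hk.
  - replace (- -1) with 1 by ring.
    replace ((_ - _) / INR k) with (c / INR k * osc_value 1 c k + / INR k * (-(1)))
      by (field; exact Hk).
    generalize (is_RInt_gen_plus (V := R_NormedModule) _ _ _ _
      (is_RInt_gen_scal (V := R_NormedModule) _ (c / INR k) _ IHs)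
      (is_RInt_gen_scal (V := R_NormedModule) _ (/ INR k) _ D2)).
    apply is_RInt_gen_ext, filter_forall; intros _ y _.
    unfold plus, scal; simpl; unfold mult; simpl.
    eq_R; field; exact Hk.
Qed.

(** * Partial fractions *)

(** Up to a power of 2, the left-hand side is 1 / (1 + y^2) times the expansion
    of 1 / (1 + y^2)^(N+1) cut after the index m; the right-hand side is the
    expansion for the next exponent, cut in the same place, and a remainder.
    The induction on m combines Pascal's rule with [inv_pow_re_SS]. *)
Lemma partial_fractions_telescope (N m : nat) (y : R) : (m <= N)%nat ->
  sum_n (fun i => Binomial.C (N + i) i * (/ 2) ^ i
                  * (2 * / (1 + y ^ 2) * inv_pow_re (S (N - i)) y)) m =
  sum_n (fun i => Binomial.C (S N + i) i * (/ 2) ^ i * inv_pow_re (S (S N - i)) y) m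
  + Binomial.C (S N + m) m * (/ 2) ^ m * (/ (1 + y ^ 2) * inv_pow_re (N - m) y).
Proof.
  induction m as [|m IH]; intros Hm.
  - rewrite !sum_O, !Nat.add_0_r, !Nat.sub_0_r, !C_n_0, inv_pow_re_SS; eq_R; ring.
  - rewrite !sum_Sn, IH by lia.
    change (@plus _) with Rplus.
    replace (N - m)%nat with (S (N - S m)) by lia.
    replace (S (S N - S m)) with (S (S (N - S m))) by lia.
    replace (S N + S m)%nat with (S (S N + m)) by lia.
    replace (N + S m)%nat with (S N + m)%nat by lia.
    rewrite <- (pascal (S N + m) m) by lia.
    replace (inv_pow_re (S (S (N - S m))) y) with
      (2 * / (1 + y ^ 2) * inv_pow_re (S (N - S m)) y
       - / (1 + y ^ 2) * inv_pow_re (N - S m) y) by (rewrite inv_pow_re_SS; ring).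
    eq_R; simpl pow; field; intros H; nra.
Qed.

(** The partial fraction expansion with n = N + 1 and k = n - i. *)
Lemma partial_fractions_rev (N : nat) (y : R) :
  (/ (1 + y ^ 2)) ^ S N =
  (/ 2) ^ N * sum_n (fun i => Binomial.C (N + i) i * (/ 2) ^ i
                              * inv_pow_re (S (N - i)) y) N.
Proof.
  induction N as [|N IH].
  - rewrite sum_O, C_n_0; unfold inv_pow_re; simpl; eq_R; field; intros H; nra.
  - rewrite <- tech_pow_Rmult, IH.
    rewrite sum_Sn; change (@plus _) with Rplus.
    (* the last term of the new sum is exactly the remainder of the telescoping *)
    assert (HC : Binomial.C (S N + S N) (S N) = 2 * Binomial.C (S N + N) N).
    { replace (S N + S N)%nat with (S (S N + N)) by lia.
      rewrite <- pascal, (pascal_step1 (S N + N) (S N)) by lia.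
      replace (S N + N - S N)%nat with N by lia; ring. }
    rewrite HC, !Nat.sub_diag.
    replace (inv_pow_re 1 y) with (/ (1 + y ^ 2) * inv_pow_re 0 y)
      by (unfold inv_pow_re; simpl; field; intros H; nra).
    pose proof (partial_fractions_telescope N N y (Nat.le_refl N)) as HT.
    rewrite Nat.sub_diag in HT.
    rewrite (sum_n_ext _ (fun i => 2 * / (1 + y ^ 2) *
      (Binomial.C (N + i) i * (/ 2) ^ i * inv_pow_re (S (N - i)) y))) in HT
      by (intros i; eq_R; ring).
    rewrite (sum_n_mult_l (K := R_Ring)) in HT.
    change (@mult R_Ring) with Rmult in HT.
    set (A := sum_n _ N) in *.
    match type of HT with _ = ?B + _ => set (B' := B) in * end.
    transitivity ((/ 2) ^ S N * (2 * / (1 + y ^ 2) * A)).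
    + simpl; field; intros H; nra.
    + rewrite HT; simpl; field; intros H; nra.
Qed.

Lemma sum_n_m_1_rev (f : nat -> R) (N : nat) :
  sum_n_m f 1 (S N) = sum_n (fun i => f (S (N - i))) N.
Proof.
  induction N as [|N IH].
  - rewrite sum_O; apply (sum_n_n f).
  - rewrite sum_n_Sm, IH by lia; unfold sum_n.
    rewrite (sum_Sn_m (fun i => f (S (S N - i)))) by lia.
    rewrite Nat.sub_0_r, <- sum_n_m_S; apply Rplus_comm.
Qed.

(** The coefficient of 2 Re ((1 + i y)^(-k)) in the partial fraction expansion of
    1 / (1 + y^2)^n. *)
Definition pf_coef (n k : nat) : R :=
  Binomial.C (2 * n - k - 1) (n - 1) * powerRZ 2 (Z.of_nat k - 2 * Z.of_nat n).

Lemma partial_fractions (n : nat) (y : R) : (1 <= n)%nat ->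
  / (1 + y ^ 2) ^ n =
  sum_n_m (fun k => pf_coef n k * (2 * inv_pow_re k y)) 1 n.
Proof.
  intros Hn; destruct n as [|N]; [lia|].
  rewrite sum_n_m_1_rev, <- pow_inv, partial_fractions_rev.
  rewrite <- (sum_n_mult_l (K := R_Ring)).
  apply sum_n_ext_loc; intros i Hi; change (@mult R_Ring) with Rmult.
  unfold pf_coef.
  replace (2 * S N - S (N - i) - 1)%nat with (N + i)%nat by lia.
  replace (S N - 1)%nat with N by lia.
  (* C(N+i, N) = C(N+i, i) *)
  rewrite (pascal_step1 (N + i) N) by lia.
  replace (N + i - N)%nat with i by lia.
  replace (Z.of_nat (S (N - i)) - 2 * Z.of_nat (S N))%Z with
    (- Z.of_nat (S (N + i)))%Z by lia.
  rewrite powerRZ_neg', <- pow_powerRZ, <- pow_inv.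
  eq_R; simpl; rewrite pow_add; field.
Qed.

(** * The integral formula *)

Lemma is_RInt_gen_sum (Fa Fb : (R -> Prop) -> Prop) {HFa : Filter Fa}
    {HFb : Filter Fb} (f : nat -> R -> R) (l : nat -> R) (m n : nat) :
  (m <= n)%nat ->
  (forall k, (m <= k <= n)%nat -> is_RInt_gen (f k) Fa Fb (l k)) ->
  is_RInt_gen (fun x => sum_n_m (fun k => f k x) m n) Fa Fb (sum_n_m l m n).
Proof.
  induction n as [|n IH]; intros Hmn H.
  - replace m with 0%nat in * by lia.
    rewrite sum_n_n.
    apply (is_RInt_gen_ext (f 0%nat)); [|now apply H].
    apply filter_forall; intros _ x _; now rewrite sum_n_n.
  - destruct (Nat.eq_dec m (S n)) as [->|Hne].
    + rewrite sum_n_n.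
      apply (is_RInt_gen_ext (f (S n))); [|now apply H].
      apply filter_forall; intros _ x _; now rewrite sum_n_n.
    + rewrite sum_n_Sm by lia.
      apply (is_RInt_gen_ext
        (fun x => plus (sum_n_m (fun k => f k x) m n) (f (S n) x))).
      * apply filter_forall; intros _ x _; rewrite sum_n_Sm by lia; reflexivity.
      * apply (is_RInt_gen_plus (V := R_NormedModule)).
        -- apply IH; [lia|]; intros k Hk; apply H; lia.
        -- apply H; lia.
Qed.

Lemma is_RInt_gen_scale (g : R -> R) (r l : R) : 0 < r ->
  is_RInt_gen g (at_point 0) (Rbar_locally p_infty) l ->
  is_RInt_gen (fun x => r * g (r * x)) (at_point 0) (Rbar_locally p_infty) l.
Proof.
  intros Hr Hg P HP.
  destruct (Hg P HP) as [Q S HQ [M HM] HQS].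
  apply (Filter_prod _ _ _ (fun x => x = 0) (fun X => S (r * X))).
  - reflexivity.
  - exists (M / r); intros X HX; apply HM.
    apply Rmult_lt_compat_l with (r := r) in HX; [|exact Hr].
    replace (r * (M / r)) with M in HX by (field; lra); exact HX.
  - intros x X -> HX.
    destruct (HQS 0 (r * X) HQ HX) as [v [Hv HPv]]; exists v; split; [|exact HPv].
    simpl in Hv |- *.
    apply (is_RInt_ext (fun x => scal r (g (r * x + 0)))).
    + intros x _; now rewrite Rplus_0_r.
    + apply (is_RInt_comp_lin (V := R_NormedModule) g r 0 0 X).
      now rewrite Rmult_0_r, !Rplus_0_r.
Qed.

Theorem theorem2p1 (a b : R) (n : nat) (ha : 0 < a) (hb : 0 < b) (hn : (1 <= n)%nat) :
  is_RInt_gen (fun x : R => sin (a * x) / (b ^ 2 + x ^ 2) ^ n)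
    (at_point 0) (Rbar_locally p_infty)
    (1 / b ^ (2 * n - 1) *
     sum_n_m
       (fun k : nat =>
          Binomial.C (2 * n - k - 1) (n - 1) *
          (powerRZ 2 (Z.of_nat k - 2 * Z.of_nat n) / INR (fact (k - 1))) *
          ((a * b) ^ (k - 1) *
             (exp (- (a * b)) * Ei (a * b) + (-1) ^ k * exp (a * b) * Ei (- (a * b)))
           - sum_n_m
               (fun j : nat =>
                  INR (fact (j - 1)) * (1 + (-1) ^ (k + j)) * (a * b) ^ (k - j - 1))
               1 (k - 1)))
       1 n).
Proof.
  set (c := a * b).
  assert (Hc : 0 < c) by now apply Rmult_lt_0_compat.
  assert (H1 : is_RInt_gen (fun y => sin (c * y) / (1 + y ^ 2) ^ n)
    (at_point 0) (Rbar_locally p_infty)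
    (sum_n_m (fun k => pf_coef n k * 2 * osc_value 1 c k) 1 n)).
  { apply (is_RInt_gen_ext (fun y =>
      sum_n_m (fun k => pf_coef n k * 2 * (sin (c * y) * inv_pow_re k y)) 1 n)).
    - apply filter_forall; intros _ y _.
      unfold Rdiv; rewrite (partial_fractions n y hn).
      rewrite <- (sum_n_m_mult_l (K := R_Ring)).
      apply sum_n_m_ext; intros k; change (@mult R_Ring) with Rmult; eq_R; ring.
    - apply is_RInt_gen_sum; [typeclasses eauto..|exact hn|].
      intros k Hk; destruct k as [|m]; [lia|].
      apply (is_RInt_gen_scal (V := R_NormedModule)).
      exact (proj1 (osc_integrals c m Hc)). }
  (* the substitution y = x / b *)
  apply (is_RInt_gen_scale _ (/ b)) in H1; [|now apply Rinv_0_lt_compat].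
  apply (is_RInt_gen_scal (V := R_NormedModule) _ (1 / b ^ (2 * n - 1))) in H1.
  change (@scal _ R_NormedModule) with Rmult in H1.
  replace (sum_n_m (fun k => pf_coef n k * 2 * osc_value 1 c k) 1 n) with
    (sum_n_m
       (fun k : nat =>
          Binomial.C (2 * n - k - 1) (n - 1) *
          (powerRZ 2 (Z.of_nat k - 2 * Z.of_nat n) / INR (fact (k - 1))) *
          (c ^ (k - 1) *
             (exp (- c) * Ei c + (-1) ^ k * exp c * Ei (- c))
           - sum_n_m
               (fun j : nat =>
                  INR (fact (j - 1)) * (1 + (-1) ^ (k + j)) * c ^ (k - j - 1))
               1 (k - 1)))
       1 n) in H1.
  - revert H1; apply is_RInt_gen_ext, filter_forall; intros _ x _.
    replace (c * (/ b * x)) with (a * x) by (unfold c; field; lra).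
    replace (b ^ 2 + x ^ 2) with (b ^ 2 * (1 + (/ b * x) ^ 2)) by (field; lra).
    rewrite (Rpow_mult_distr (b ^ 2)), <- pow_mult.
    replace (b ^ (2 * n)) with (b ^ (2 * n - 1) * b)
      by (rewrite Rmult_comm, tech_pow_Rmult; f_equal; lia).
    assert (HD : (1 + (/ b * x) ^ 2) ^ n <> 0)
      by apply pow_nonzero, one_plus_sqr_neq_0.
    assert (HB : b ^ (2 * n - 1) <> 0) by (apply pow_nonzero; lra).
    eq_R; field; repeat split; trivial; lra.
  - apply sum_n_m_ext; intros k; unfold osc_value, pf_coef.
    rewrite (sum_n_m_ext (fun j => _ * (1 + 1 * _) * _) (fun j =>
      INR (fact (j - 1)) * (1 + (-1) ^ (k + j)) * c ^ (k - j - 1)))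
      by (intros j; now rewrite Rmult_1_l).
    rewrite Rmult_1_l.
    eq_R; field; apply INR_fact_neq_0.
Qed.
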